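(* Consider the regression model $Y_i=\mathbf 1(X_i\in G)+\xi_i$, $i=1,\dots,n$, with i.i.d. noise that is subgaussian with parameter $\sigma$ and independent of the design, and with either design (DD) or (RD). Then the minimax risk on the class $\mathcal S_0=\{[0,\theta]:0\le\theta\le1\}$ satisfies $$\mathcal R_n(\mathcal S_0)\asymp_\sigma\frac1n,$$ i.e. there exist positive constants $c(\sigma),C(\sigma)$ depending only on $\sigma$ such that $c(\sigma)/n\le\mathcal R_n(\mathcal S_0)\le C(\sigma)/n$ for all $n$ large enough.
   Context: Model: one observes $(X_1,Y_1),\dots,(X_n,Y_n)$ with $Y_i=\mathbf 1(X_i\in G)+\xi_i$, where $G\subseteq[0,1]$ is an unknown segment. The noise variables $\xi_i$ are i.i.d., independent of the design, and satisfy $\mathbb E[e^{u\xi_i}]\le e^{\sigma^2u^2/2}$ for all $u\in\mathbb R$ ($\sigma>0$ constant). $\mathbb E_G$ is expectation when the segment is $G$. Designs: (DD) $X_i=i/n$, $i=1,\dots,n$; (RD) $X_1\le\dots\le X_n$ is the increasing reordering of $n$ i.i.d. uniform random variables on $[0,1]$. An estimator $\hat G_n$ is a (possibly empty) segment in $[0,1]$ constructed measurably from the $n$ observations. For a class $\mathcal C$ of segments, $\mathcal R_n(\hat G_n;\mathcal C)=\sup_{G\in\mathcal C}\mathbb E_G[|G\triangle\hat G_n|]$, where $|\cdot|$ is Lebesgue measure and $\triangle$ is symmetric difference; the minimax risk is $\mathcal R_n(\mathcal C)=\inf_{\tilde G_n}\mathcal R_n(\tilde G_n;\mathcal C)$,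 the infimum being over all estimators based on $n$ observations. *)

(* Defs.v *)
From HB Require Import structures.
From mathcomp Require Import all_boot all_order all_algebra.
From mathcomp Require Import all_classical all_reals all_analysis.

Set Implicit Arguments.
Unset Strict Implicit.
Unset Printing Implicit Defensive.

Import Order.TTheory GRing.Theory Num.Theory.
Import numFieldNormedType.Exports.

Local Open Scope classical_set_scope.
Local Open Scope ring_scope.

Definition mutually_independent {d} {T : measurableType d} {R : realType}
    (P : probability T R) {n : nat} (Z : 'I_n -> {RV P >-> R}) : Prop :=
  forall (J : {set 'I_n}) (A : 'I_n -> set R), (forall i, measurable (A i)) ->
    P (\bigcap_(i in [set` J]) (Z i @^-1` A i)) =
      (\prod_(i in J) P (Z i @^-1` A i))%E.

Definition identically_distributed {d} {T : measurableType d} {R : realType}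
    (P : probability T R) {n : nat} (Z : 'I_n -> {RV P >-> R}) : Prop :=
  forall (i j : 'I_n) (A : set R), measurable A ->
    distribution P (Z i) A = distribution P (Z j) A.

(* Independence of two random vectors; [n.-tuple R] carries the product
   sigma-algebra. *)
Definition independent_vectors {d} {T : measurableType d} {R : realType}
    (P : probability T R) {n m : nat} (V : T -> n.-tuple R)
    (W : T -> m.-tuple R) : Prop :=
  forall (A : set (n.-tuple R)) (B : set (m.-tuple R)),
    measurable A -> measurable B ->
    P (V @^-1` A `&` W @^-1` B) = (P (V @^-1` A) * P (W @^-1` B))%E.

Definition subgaussian {d} {T : measurableType d} {R : realType}
    (P : probability T R) (sigma : R) (Z : {RV P >-> R}) : Prop :=
  forall u : R,
    ('E_P[fun w => expR (u * Z w)] <= (expR (sigma ^+ 2 * u ^+ 2 / 2))%:E)%E.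

Definition noise_model {d} {T : measurableType d} {R : realType}
    (P : probability T R) (sigma : R) {n : nat}
    (X : {RV P >-> n.-tuple R}) (xi : 'I_n -> {RV P >-> R}) : Prop :=
  [/\ mutually_independent xi, identically_distributed xi,
      forall i, subgaussian sigma (xi i) &
      independent_vectors P X (fun w => [tuple xi i w | i < n])].

(* Ordinals start at 0, hence the successor: the points are 1/n, ..., n/n. *)
Definition deterministic_design {d} {T : measurableType d} {R : realType}
    (P : probability T R) {n : nat} (X : {RV P >-> n.-tuple R}) : Prop :=
  forall (w : T) (i : 'I_n), tnth (X w) i = i.+1%:R / n%:R.

Definition random_design {d} {T : measurableType d} {R : realType}
    (P : probability T R) {n : nat} (X : {RV P >-> n.-tuple R}) : Prop :=
  exists U : 'I_n -> {RV P >-> R},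
    [/\ mutually_independent U,
        forall (i : 'I_n) (A : set R), measurable A ->
          distribution P (U i) A = uniform_prob (@ltr01 R) A &
        forall w : T, X w = [tuple of sort <=%R [tuple U i w | i < n]]].

Definition observations {d} {T : measurableType d} {R : realType}
    (P : probability T R) {n : nat} (X : {RV P >-> n.-tuple R})
    (xi : 'I_n -> {RV P >-> R}) (G : set R) (w : T) : n.-tuple (R * R) :=
  [tuple (tnth (X w) i, \1_G (tnth (X w) i) + xi i w) | i < n].

(* Measurability of a segment-valued map is measurability of its endpoints;
   the segment is empty where the left endpoint a exceeds the right one b.
   Taking segments closed does not affect measures of symmetric differences. *)
Definition estimator {R : realType} {n : nat}
    (Ghat : n.-tuple (R * R) -> set R) : Prop :=
  exists a b : n.-tuple (R * R) -> R,
    [/\ measurable_fun setT a, measurable_fun setT b,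
        forall z, 0 <= a z <= 1 /\ 0 <= b z <= 1 &
        forall z, Ghat z = `[a z, b z]%classic].

Definition risk {d} {T : measurableType d} {R : realType}
    (P : probability T R) {n : nat} (X : {RV P >-> n.-tuple R})
    (xi : 'I_n -> {RV P >-> R}) (Ghat : n.-tuple (R * R) -> set R)
    (C : set (set R)) : \bar R :=
  ereal_sup [set (\int[P]_w
    (@lebesgue_measure R (G `+` Ghat (observations X xi G w))))%E | G in C].

Definition minimax_risk {d} {T : measurableType d} {R : realType}
    (P : probability T R) {n : nat} (X : {RV P >-> n.-tuple R})
    (xi : 'I_n -> {RV P >-> R}) (C : set (set R)) : \bar R :=
  ereal_inf [set risk X xi Ghat C | Ghat in @estimator R n].

Definition segments_from_0 {R : realType} : set (set R) :=
  [set `[0, theta]%classic | theta in `[0%R : R, 1%R]].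

(* Main.v *)
(** Lower bound: with probability at least 1/2 no design point falls in
    [0, 1/(2n)], and then the segments {0} and [0, 1/(2n)] produce the same
    observations, whatever the noise is.

    Upper bound: let S_k be the sum of Y_i - 1/2 over the first k observations.
    The estimator averages the design points with weights proportional to
    exp(lam S_k), lam = 1/(2 sigma^2). If k* is the number of design points at
    most theta, its error is at most the sum over k of
    |X_k - theta| exp(lam (S_k - S_k* )), and S_k - S_k* is a sum of |k - k*|
    noise variables, up to sign, with drift -1/2 each. Integrating out the noise
    leaves the sum of |X_k - theta| r^|k - k*| with r = exp(-1/(8 sigma^2)).
    Cutting |X_k - theta| into steps of length 1/n reduces this to
    E r^N <= exp(-(1 - r) j), where N counts the design points in an interval of
    length j/n, and a geometric series in j remains. *)

Require Import Defs.
From HB Require Import structures.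
From mathcomp Require Import all_boot all_order all_algebra.
From mathcomp Require Import all_classical all_reals all_analysis.
From mathcomp Require Import measurable_realfun.
From mathcomp Require Import ring lra zify.

Set Implicit Arguments.
Unset Strict Implicit.
Unset Printing Implicit Defensive.

Import Order.TTheory GRing.Theory Num.Theory.
Import numFieldNormedType.Exports.

Local Open Scope classical_set_scope.
Local Open Scope ring_scope.

(** * Integrals of products of independent factors *)

(* The section confines the simple-function instances of [HBNNSimple]. *)
Section IndependenceFactorization.
Import HBNNSimple.

(** Linearity carries the identity from indicators to simple functions, and monotone convergence
    carries it to [f]. The weight [h] plays the role of a factor independent of [Z] with mean [c],
    so that an indicator factor can be freed into a general one while the rest of a product stays
    inside [h]. *)
Lemma integral_indep_ge0 {d d'} {T : measurableType d} {T' : measurableType d'}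
    {R : realType} (P : probability T R) (h : T -> R) (Z : T -> T') (c : R) :
  measurable_fun setT h -> (forall w, 0 <= h w) -> measurable_fun setT Z ->
  0 <= c ->
  (forall A, measurable A ->
     (\int[P]_w (h w * \1_A (Z w))%:E = c%:E * P (Z @^-1` A))%E) ->
  forall f : T' -> R, measurable_fun setT f -> (forall y, 0 <= f y) ->
  (\int[P]_w (h w * f (Z w))%:E = c%:E * \int[P]_w (f (Z w))%:E)%E.
Proof.
move=> mh h0 mZ c0 hA f mf f0.
have /measurable_EFinP mfE := mf.
pose s := nnsfun_approx measurableT mfE.
have nds w : {homo (fun n => s n (Z w)) : n m / (n <= m)%N >-> n <= m}.
  by move=> n m nm; exact/lefP/nd_nnsfun_approx.
have cvs w : (s n (Z w))%:E @[n --> \oo] --> (f (Z w))%:E.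
  by apply: cvg_nnsfun_approx => // x _; rewrite lee_fin.
have msZ n : measurable_fun setT (fun w => s n (Z w)) by exact: measurableT_comp.
have mZA A : measurable A -> measurable (Z @^-1` A).
  by move=> mA; rewrite -[X in measurable X]setTI; exact: mZ.
have -> : (\int[P]_w (h w * f (Z w))%:E =
    limn (fun n => \int[P]_w (h w * s n (Z w))%:E))%E.
  rewrite -monotone_convergence//.
  - apply: eq_integral => w _; apply/esym/cvg_lim => //.
    under eq_fun do rewrite EFinM.
    by rewrite EFinM; apply: cvgeZl => //; exact: cvs.
  - by move=> n; exact/measurable_EFinP/measurable_funM.
  - by move=> n w _; rewrite lee_fin mulr_ge0.
  - by move=> w _ n m nm; rewrite lee_fin ler_wpM2l//; exact: nds.
have -> : (\int[P]_w (f (Z w))%:E = limn (fun n => \int[P]_w (s n (Z w))%:E))%E.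
  rewrite -monotone_convergence//.
  - by apply: eq_integral => w _; apply/esym/cvg_lim => //; exact: cvs.
  - by move=> n; exact/measurable_EFinP.
  - by move=> n w _; rewrite lee_fin.
  - by move=> w _ n m nm; rewrite lee_fin; exact: nds.
rewrite -limeMl//; last first.
  apply: ereal_nondecreasing_is_cvgn => n m nm; apply: ge0_le_integral => //.
  - by move=> w _; rewrite lee_fin.
  - exact/measurable_EFinP.
  - exact/measurable_EFinP.
  - by move=> w _; rewrite lee_fin; exact: nds.
congr (limn _); apply/funext => n.
have mI y : measurable_fun setT (\1_(s n @^-1` [set y]) \o Z : T -> R).
  by apply: measurableT_comp => //; exact: measurable_indic.
(* The finite-support sums ask for nonnegative terms at every real [y], not only at values of [s n];
   a negative [y] has an empty fibre. *)
have sP y : 0 <= y \/ s n @^-1` [set y] = set0.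
  have [|y0] := leP 0 y; [by left|right].
  by apply/seteqP; split => // x /= sx; move: y0; rewrite -sx ltNge fun_ge0.
transitivity (\sum_(y \in range (s n))
    \int[P]_w (y * (h w * \1_(s n @^-1` [set y]) (Z w)))%:E)%E.
  rewrite -ge0_integral_fsum//.
  - apply: eq_integral => w _; rewrite fsumEFin//; congr (_%:E).
    rewrite fimfunE mulr_fsumr.
    by apply: eq_fsbigr => y _; rewrite mulrCA.
  - move=> y; apply/measurable_EFinP/measurable_funM => //.
    exact: measurable_funM mh (mI y).
  - move=> y w _; rewrite lee_fin; have [y0|->] := sP y.
      by rewrite !mulr_ge0.
    by rewrite indic0 !mulr0.
transitivity (\sum_(y \in range (s n))
    c%:E * \int[P]_w (y * \1_(s n @^-1` [set y]) (Z w))%:E)%E.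
  apply: eq_fsbigr => y _; have [y0|->] := sP y; last first.
    under eq_integral do rewrite indic0 !mulr0.
    under [in RHS]eq_integral do rewrite indic0 !mulr0.
    by rewrite !integral0 mule0.
  under eq_integral do rewrite EFinM.
  rewrite ge0_integralZl_EFin//; last 2 first.
  - by move=> w _; rewrite lee_fin mulr_ge0.
  - apply/measurable_EFinP; exact: measurable_funM mh (mI y).
  rewrite hA//.
  under [in RHS]eq_integral do rewrite EFinM.
  rewrite ge0_integralZl_EFin//; last first.
    by apply/measurable_EFinP; exact: mI.
  rewrite muleCA; congr (_ * (_ * _))%E.
  rewrite -[RHS]/(\int[P]_w (\1_(Z @^-1` (s n @^-1` [set y])) w)%:E)%E.
  by rewrite integral_indic// ?setIT//; exact: mZA.
rewrite -ge0_mule_fsumr; last first.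
  move=> y; apply: integral_ge0 => w _; rewrite lee_fin.
  by have [y0|->] := sP y; rewrite ?indic0 ?mulr0// mulr_ge0.
congr (c%:E * _)%E; rewrite -ge0_integral_fsum//.
- by apply: eq_integral => w _; rewrite fsumEFin// [in RHS]fimfunE.
- move=> y; apply/measurable_EFinP/measurable_funM => //; exact: mI.
- move=> y w _; rewrite lee_fin; have [y0|->] := sP y.
    by rewrite mulr_ge0.
  by rewrite indic0 !mulr0.
Qed.

End IndependenceFactorization.

Lemma integral_indic_comp {d d'} {T : measurableType d} {T' : measurableType d'}
    {R : realType} (P : probability T R) (Z : T -> T') (A : set T') :
  measurable_fun setT Z -> measurable A ->
  (\int[P]_w (\1_A (Z w))%:E = P (Z @^-1` A))%E.
Proof.
move=> mZ mA; rewrite -[LHS]/(\int[P]_w (\1_(Z @^-1` A) w)%:E)%E.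
by rewrite integral_indic// ?setIT// -[X in measurable X]setTI; exact: mZ.
Qed.

(** Induction on the number [k] of factors allowed to be arbitrary, those of index at least [k]
    being indicators. With indicators only, the claim is mutual independence itself; the step frees
    the factor of index [k] through [integral_indep_ge0]. *)
Lemma integral_prod_independent {d} {T : measurableType d} {R : realType}
    (P : probability T R) {n : nat} (Z : 'I_n -> {RV P >-> R})
    (f : 'I_n -> R -> R) (m : 'I_n -> R) :
  mutually_independent Z ->
  (forall i, measurable_fun setT (f i)) -> (forall i y, 0 <= f i y) ->
  (forall i, \int[P]_w (f i (Z i w))%:E = (m i)%:E)%E ->
  (\int[P]_w (\prod_(i < n) f i (Z i w))%:E = (\prod_(i < n) m i)%:E)%E.
Proof.
move=> indZ.
suff H k : forall (f : 'I_n -> R -> R) (m : 'I_n -> R), (forall i : 'I_n, (k <= i)%N ->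
      exists2 A, measurable A & f i = \1_A) ->
    (forall i, measurable_fun setT (f i)) -> (forall i y, 0 <= f i y) ->
    (forall i, \int[P]_w (f i (Z i w))%:E = (m i)%:E)%E ->
    (\int[P]_w (\prod_(i < n) f i (Z i w))%:E = (\prod_(i < n) m i)%:E)%E.
  apply: (H n) => i; by rewrite leqNgt ltn_ord.
elim: k => [|k IH] {}f {}m fA mf f0 fm.
  have /choice [A AP] : forall i, exists A : set R, measurable A /\ f i = \1_A.
    by move=> i; have [B mB ->] := fA i (leq0n i); exists B.
  have mA i : measurable (A i) by have [] := AP i.
  have PA i : P (Z i @^-1` A i) = (m i)%:E.
    by rewrite -integral_indic_comp// -fm; have [_ ->] := AP i.
  have mC : measurable (\bigcap_(i in [set` [set: 'I_n]%SET]) (Z i @^-1` A i)).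
    apply: fin_bigcap_measurable => // i _.
    by rewrite -[X in measurable X]setTI; exact: measurable_funP.
  transitivity (P (\bigcap_(i in [set` [set: 'I_n]%SET]) (Z i @^-1` A i))); last first.
    rewrite indZ// -prodEFin; apply: eq_big => [i|i _]; rewrite ?inE//.
  rewrite -[in RHS](setIT (\bigcap_(i in _) _)) -integral_indic//.
  apply: eq_integral => w _; congr (_%:E).
  under eq_bigr do rewrite (proj2 (AP _)).
  have [wA|wA] := pselect (forall i, A i (Z i w)).
    rewrite indicE mem_set; last by move=> i _; exact: wA.
    by rewrite big1// => i _; rewrite indicE mem_set.
  rewrite indicE memNset; last by move=> H; apply: wA => i; apply: H => /=; rewrite inE.
  have /existsNP [i Ai] := wA.
  by rewrite (bigD1 i)//= indicE memNset// mul0r.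
have [kn|nk] := ltnP k n; last first.
  by apply: IH => // i ki; move: (leq_ltn_trans (leq_trans nk ki) (ltn_ord i)); rewrite ltnn.
pose i0 := Ordinal kn.
pose h w := \prod_(i < n | i != i0) f i (Z i w).
pose c := \prod_(i < n | i != i0) m i.
have m0 i : 0 <= m i.
  by rewrite -lee_fin -fm; apply: integral_ge0 => w _; rewrite lee_fin.
under eq_integral do rewrite (bigD1 i0)//= mulrC.
rewrite (integral_indep_ge0 (h := h) (c := c))//.
- by rewrite fm (bigD1 i0)//= -EFinM mulrC.
- rewrite /h; under eq_fun do rewrite big_mkcond.
  apply: measurable_prod => i _; case: (i != i0) => //.
  by apply: measurableT_comp => //; exact: measurable_funP.
- by move=> w; exact: prodr_ge0.
- exact: prodr_ge0.
- move=> A mA.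
  (* With an indicator in place of the factor [i0], the induction hypothesis applies; [q] collects
     the means of the new family. *)
  pose g i := if i == i0 then \1_A else f i : R -> R.
  pose q i := if i == i0 then fine (P (Z i0 @^-1` A)) else m i.
  have gE w : \prod_(i < n) g i (Z i w) = h w * \1_A (Z i0 w).
    rewrite (bigD1 i0)//= /g eqxx mulrC; congr (_ * _).
    by apply: eq_bigr => i /negPf ->.
  have qE : \prod_(i < n) q i = c * fine (P (Z i0 @^-1` A)).
    rewrite (bigD1 i0)//= /q eqxx mulrC; congr (_ * _).
    by apply: eq_bigr => i /negPf ->.
  have mZA : measurable (Z i0 @^-1` A).
    by rewrite -[X in measurable X]setTI; exact: measurable_funP.
  under eq_integral do rewrite -gE.
  rewrite (IH g q) ?qE ?EFinM ?fineK ?fin_num_measure//.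
  - move=> i ki; rewrite /g; case: eqVneq => [_|ii0]; first by exists A.
    by apply: fA; rewrite ltn_neqAle ki andbT eq_sym.
  - by move=> i; rewrite /g; case: eqVneq => // _; exact: measurable_indic.
  - by move=> i y; rewrite /g; case: eqVneq.
  - move=> i; rewrite /g /q; case: eqVneq => [->|//].
    by rewrite integral_indic_comp// fineK// fin_num_measure.
Qed.

(** The factorization is used twice: first to free [g] with [f \o V] as weight, then, for an
    indicator of [W] as weight, to free [f]. What remains concerns two indicators, which is the
    definition of independence. *)
Lemma integral_mul_independent_vectors {d} {T : measurableType d}
    {R : realType} (P : probability T R) {n m : nat} (V : T -> n.-tuple R)
    (W : T -> m.-tuple R) (f : n.-tuple R -> R) (g : m.-tuple R -> R) (a : R) :
  independent_vectors P V W -> measurable_fun setT V -> measurable_fun setT W ->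
  measurable_fun setT f -> (forall x, 0 <= f x) ->
  measurable_fun setT g -> (forall y, 0 <= g y) ->
  (\int[P]_w (f (V w))%:E = a%:E)%E ->
  (\int[P]_w (f (V w) * g (W w))%:E = a%:E * \int[P]_w (g (W w))%:E)%E.
Proof.
move=> indVW mV mW mf f0 mg g0 fa.
have mVA A : measurable A -> measurable (V @^-1` A).
  by move=> mA; rewrite -[X in measurable X]setTI; exact: mV.
have mWA A : measurable A -> measurable (W @^-1` A).
  by move=> mA; rewrite -[X in measurable X]setTI; exact: mW.
apply: (integral_indep_ge0 (h := f \o V)) => //=.
- exact: measurableT_comp.
- by rewrite -lee_fin -fa; apply: integral_ge0 => w _; rewrite lee_fin.
move=> B mB; under eq_integral do rewrite mulrC.
rewrite (@integral_indep_ge0 _ _ _ _ _ P (\1_B \o W) V (fine (P (W @^-1` B))))//=.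
- by rewrite fineK ?fin_num_measure//; [rewrite fa muleC|exact: mWA].
- by apply: measurableT_comp => //; exact: measurable_indic.
- by rewrite fine_ge0.
move=> A mA; rewrite fineK ?fin_num_measure//; last exact: mWA.
rewrite muleC -indVW//.
rewrite -[in RHS](setIT (_ `&` _)) -integral_indic//; last first.
  by apply: measurableI; [exact: mVA|exact: mWA].
by apply: eq_integral => w _; rewrite indicI mulrC.
Qed.

(** * Deterministic bounds along a sorted design *)

(** The exponent is the distance between [k] and [a]: of the two truncated differences at least one
    is zero. Two geometric series, one on each side of [a], give a bound free of [m] and [a]. *)
Lemma sum_expr_dist_le (R : realFieldType) (r : R) (m a : nat) :
  0 <= r < 1 ->
  \sum_(k < m) r ^+ ((k - a) + (a - k)) <= 2 / (1 - r).
Proof.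
move=> /andP[r0 r1]; rewrite ler_pdivlMr ?subr_gt0//.
(* The constant 2 alone does not pass through the induction on [m]; this remainder, itself at most
   2, does, and covers both sides of [a] in one formula. *)
suff : (\sum_(k < m) r ^+ ((k - a) + (a - k))) * (1 - r) <=
    r ^+ (a - m) + 1 - r ^+ (m - a).
  move=> /le_trans; apply.
  have := exprn_ile1 (a - m) r0 (ltW r1); have := exprn_ge0 (m - a) r0.
  by lra.
elim: m => [|m IH]; first by rewrite big_ord0 mul0r subn0 sub0n addrK exprn_ge0.
rewrite big_ord_recr/= mulrDl.
have [am|ma] := leqP a m.
  have -> : (a - m.+1)%N = 0%N by lia.
  have -> : (m.+1 - a)%N = (m - a).+1 by lia.
  move: IH; have -> : (a - m)%N = 0%N by lia.
  by rewrite addn0 !exprS expr0; set x := r ^+ _ => IH; lra.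
have -> : (m.+1 - a)%N = 0%N by lia.
move: IH; have -> : (m - a)%N = 0%N by lia.
have -> : (a - m)%N = (a - m.+1).+1 by lia.
rewrite add0n !exprS expr0.
have : 0 <= r ^+ (a - m.+1) by rewrite exprn_ge0.
set x := r ^+ _ => x0 IH.
have : 0 <= x * (1 - r) ^+ 2 by rewrite mulr_ge0// sqr_ge0.
by nra.
Qed.

(** A discrete layer-cake bound: it replaces a length by a sum of indicators, so that distances can
    be treated one step at a time. *)
Lemma le_sum_lt_natr (R : realDomainType) (n : nat) (v : R) :
  v <= n%:R -> v <= 1 + \sum_(j < n) (j.+1%:R < v)%R%:R.
Proof.
elim: n => [|n IH] vn; first by rewrite big_ord0 addr0 (le_trans vn).
rewrite big_ord_recr/=.
have [/IH {}IH|nv] := leP v n%:R.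
  by rewrite addrA ler_wpDr.
rewrite (eq_bigr (fun=> 1)); last first.
  by move=> j _; rewrite (le_lt_trans _ nv)// ler_nat.
by rewrite sumr_const card_ord addrA nat1r ler_wpDr.
Qed.

Definition clip {R : realDomainType} (y : R) : R := Num.max 0 (Num.min 1 y).

(* Index 0 stands for the candidate endpoint 0. Clipping is needed because under
   the random design the points lie in [0, 1] only almost surely. *)
Definition node {R : realDomainType} (x : seq R) (k : nat) : R :=
  clip (nth 0 (0 :: x) k).

Definition ncount {R : realDomainType} (x : seq R) (t : R) : nat :=
  count (<= t) x.

Lemma clip_itv (R : realDomainType) (y : R) : 0 <= clip y <= 1.
Proof. by rewrite /clip le_max lexx/= ge_max ler01 ge_min lexx. Qed.

(** Since index 0 is taken by the endpoint 0, node [k] is the clipped [k]-th smallest point, and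
    node indices compare directly with counts. Here [0 <= t], and in the next lemma [t <= 1], makes
    clipping harmless. *)
Lemma ncount_le_of_lt_node (R : realDomainType) (x : seq R) (t : R) (k : nat) :
  sorted <=%R x -> 0 <= t -> t < node x k -> (ncount x t <= k)%N.
Proof.
move=> sx t0; rewrite /node /clip lt_max ltNge t0/= lt_min => /andP[_].
case: k => [|i] /=; first by rewrite ltNge t0.
move=> ti; rewrite leqNgt; apply/negP => /ltnW ik; move: ti.
by rewrite ltNge (nth_count_le _ sx).
Qed.

Lemma le_ncount_of_node_lt (R : realDomainType) (x : seq R) (t : R) (k : nat) :
  sorted <=%R x -> (k <= size x)%N -> t <= 1 -> node x k < t ->
  (k <= ncount x t)%N.
Proof.
move=> sx kx t1; rewrite /node /clip gt_max => /andP[_].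
rewrite gt_min ltNge t1/=; case: k kx => [//|i] /= ix xt.
rewrite ltnNge; apply/negP => ki; move: xt.
by rewrite ltNge ltW// (nth_count_gt _ sx)// ki.
Qed.

(** Each distance is cut into steps of length [1/n]. If node [k] lies beyond [theta + w j], the
    count at that point is between the count at [theta] and [k], so the power of [r] splits there
    into two factors. Summing over [k] first, one factor costs [2 / (1 - r)] by [sum_expr_dist_le];
    the other involves only the design points between [theta] and [theta + w j]. The left side is
    symmetric. *)
Lemma sum_node_dist_le (R : realFieldType) (n : nat) (x : seq R) (theta r : R) :
  (0 < n)%N -> size x = n -> sorted <=%R x -> 0 <= theta <= 1 -> 0 <= r < 1 ->
  \sum_(k < n.+1) `|node x k - theta| *
      r ^+ ((k - ncount x theta) + (ncount x theta - k)) <=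
  2 / (1 - r) / n%:R * (1 + \sum_(j < n)
    ((theta + j.+1%:R / n%:R < 1)%R%:R *
       r ^+ (ncount x (theta + j.+1%:R / n%:R) - ncount x theta) +
     (0 < theta - j.+1%:R / n%:R)%R%:R *
       r ^+ (ncount x theta - ncount x (theta - j.+1%:R / n%:R)))).
Proof.
move=> n0 sx srt /andP[t0 t1] r01; have /andP[r0 r1] := r01.
have nR0 : 0 < n%:R :> R by rewrite ltr0n.
set d := fun k l : nat => ((k - l) + (l - k))%N.
set K := ncount x; set w := fun j : nat => j.+1%:R / n%:R : R.
have w0 j : 0 <= w j by rewrite divr_ge0.
have step (k : 'I_n.+1) (j : nat) :
    (w j < `|node x k - theta|)%R%:R * r ^+ d k (K theta) <=
    (theta + w j < 1)%R%:R * (r ^+ (K (theta + w j) - K theta) *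
      r ^+ d k (K (theta + w j))) +
    (0 < theta - w j)%R%:R * (r ^+ (K theta - K (theta - w j)) *
      r ^+ d k (K (theta - w j))).
  have [wk|_] := ltP; last by rewrite mul0r addr_ge0 ?mulr_ge0 ?exprn_ge0.
  have /andP[c0 c1] := clip_itv (nth 0 (0 :: x) k); rewrite -/(node x k) in c0 c1.
  rewrite mul1r -!exprD; have [kt|kt] := leP theta (node x k).
    have lk : theta + w j < node x k.
      by move: wk; rewrite ger0_norm ?subr_ge0// ltrBrDl.
    (* Nodes lie in [[0, 1]], hence so does the shifted endpoint; the indicator keeps this fact for
       the integration over the design. *)
    rewrite (lt_le_trans lk c1) mul1r ler_wpDr ?mulr_ge0 ?exprn_ge0//.
    have Kk : (K (theta + w j)%R <= k)%N.
      by apply: ncount_le_of_lt_node => //; rewrite addr_ge0.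
    have KK : (K theta <= K (theta + w j)%R)%N.
      by apply: sub_count => y /= /le_trans; apply; rewrite lerDl.
    by rewrite le_eqVlt; apply/orP; left; apply/eqP; congr (_ ^+ _); rewrite /d; lia.
  have lk : node x k < theta - w j.
    by move: wk; rewrite ltr0_norm ?subr_lt0// opprB ltrBrDl ltrBrDr addrC.
  rewrite (le_lt_trans c0 lk) mul1r ler_wpDl ?mulr_ge0 ?exprn_ge0//.
  have Kk : (k <= K (theta - w j)%R)%N.
    apply: le_ncount_of_node_lt => //; first by rewrite sx -ltnS.
    by rewrite (le_trans _ t1)// gerBl.
  have KK : (K (theta - w j)%R <= K theta)%N.
    by apply: sub_count => y /= /le_trans; apply; rewrite gerBl.
  by rewrite le_eqVlt; apply/orP; left; apply/eqP; congr (_ ^+ _); rewrite /d; lia.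
have dk (k : 'I_n.+1) : `|node x k - theta| <=
    n%:R^-1 * (1 + \sum_(j < n) (w j < `|node x k - theta|)%R%:R).
  rewrite ler_pdivlMl// (le_trans (le_sum_lt_natr (n := n) _))//.
    have /andP[c0 c1] := clip_itv (nth 0 (0 :: x) k); rewrite -/(node x k) in c0 c1.
    by rewrite ler_piMr// ler_norml; apply/andP; split; lra.
  rewrite lerD2l; apply: ler_sum => j _.
  by rewrite /w ltr_pdivrMr// mulrC.
apply: (@le_trans _ _ (\sum_(k < n.+1) n%:R^-1 * (r ^+ d k (K theta) +
    \sum_(j < n) ((theta + w j < 1)%R%:R * (r ^+ (K (theta + w j) - K theta) *
      r ^+ d k (K (theta + w j))) +
    (0 < theta - w j)%R%:R * (r ^+ (K theta - K (theta - w j)) *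
      r ^+ d k (K (theta - w j))))))).
  apply: ler_sum => k _.
  apply: (le_trans (ler_wpM2r (exprn_ge0 _ r0) (dk k))).
  rewrite -mulrA ler_wpM2l ?invr_ge0//  mulrDl mul1r lerD2l mulr_suml.
  by apply: ler_sum => j _; exact: step.
rewrite -mulr_sumr [leRHS]mulrAC [leRHS]mulrC ler_wpM2l ?invr_ge0//.
rewrite big_split/= mulrDr mulr1 lerD//; first exact: sum_expr_dist_le.
rewrite exchange_big/= mulr_sumr; apply: ler_sum => j _.
rewrite big_split/= mulrDr; apply: lerD.
  rewrite -mulr_sumr mulrCA ler_wpM2l// -mulr_sumr mulrC.
  by rewrite ler_wpM2r ?exprn_ge0//; exact: sum_expr_dist_le.
rewrite -mulr_sumr mulrCA ler_wpM2l// -mulr_sumr mulrC.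
by rewrite ler_wpM2r ?exprn_ge0//; exact: sum_expr_dist_le.
Qed.

(** * The exponentially weighted estimator *)

Section ExponentialWeights.
Context {R : realType} {n : nat}.
Implicit Types (z : n.-tuple (R * R)) (lam : R) (k l : nat).

(** The value 1/2 is midway between the two values of the regression function, so the drift is
    upward inside the segment and downward outside it. *)
Definition excess z k : R := \sum_(i < n | (i < k)%N) ((tnth z i).2 - 2^-1).

(* The normalisation sits inside the exponential to avoid proving that the
   inverse is measurable. *)
Definition weight lam z k : R :=
  expR (lam * excess z k - ln (\sum_(j < n.+1) expR (lam * excess z j))).

Definition theta_hat lam z : R :=
  \sum_(k < n.+1) weight lam z k * node [seq p.1 | p <- z] k.

Let sum_expR_gt0 lam z : 0 < \sum_(j < n.+1) expR (lam * excess z j).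
Proof.
rewrite big_ord_recl ltr_pwDl ?expR_gt0//.
by apply: sumr_ge0 => j _; exact: expR_ge0.
Qed.

Lemma sum_weight lam z : \sum_(k < n.+1) weight lam z k = 1.
Proof.
under eq_bigr do rewrite /weight expRD expRN lnK ?posrE//.
by rewrite -mulr_suml divff// gt_eqF.
Qed.

(** The normalising sum is at least its [l]-th term. *)
Lemma weight_le lam z k (l : 'I_n.+1) :
  weight lam z k <= expR (lam * (excess z k - excess z l)).
Proof.
rewrite /weight mulrBr ler_expR lerD2l lerN2.
rewrite -[X in X <= _](expRK (lam * excess z l)).
rewrite ler_ln ?posrE ?expR_gt0// (bigD1 l)//= ler_wpDr//.
by apply: sumr_ge0 => j _; exact: expR_ge0.
Qed.

Lemma theta_hat_itv lam z : 0 <= theta_hat lam z <= 1.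
Proof.
apply/andP; split.
  apply: sumr_ge0 => k _; rewrite mulr_ge0 ?expR_ge0//.
  by case/andP: (clip_itv (nth 0 (0 :: [seq p.1 | p <- z]) k)).
rewrite -(sum_weight lam z); apply: ler_sum => k _.
rewrite ler_piMr ?expR_ge0//.
by case/andP: (clip_itv (nth 0 (0 :: [seq p.1 | p <- z]) k)).
Qed.

(** The weights add up to 1, so the error is a weighted mean of the node errors and the triangle
    inequality applies. The index [l] is free here; later it is the number of design points in the
    true segment. *)
Lemma theta_hat_dist_le lam z (theta : R) (l : 'I_n.+1) :
  `|theta_hat lam z - theta| <= \sum_(k < n.+1)
    `|node [seq p.1 | p <- z] k - theta| * expR (lam * (excess z k - excess z l)).
Proof.
have -> : theta_hat lam z - theta =
    \sum_(k < n.+1) weight lam z k * (node [seq p.1 | p <- z] k - theta).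
  rewrite -[X in _ - X]mul1r -(sum_weight lam z) mulr_suml -sumrB.
  by apply: eq_bigr => k _; rewrite mulrBr.
rewrite (le_trans (ler_norm_sum _ _ _))//; apply: ler_sum => k _.
by rewrite normrM mulrC ler_wpM2l// ger0_norm ?expR_ge0// weight_le.
Qed.

Lemma measurable_excess k : measurable_fun setT (fun z => excess z k).
Proof.
rewrite /excess; under eq_fun do rewrite big_mkcond.
apply: measurable_sum => i; case: (i < k)%N => //.
apply: measurable_funB => //.
exact: (measurableT_comp measurable_snd (measurable_tnth i)).
Qed.

Lemma measurable_clip : measurable_fun setT (@clip R).
Proof. by apply: measurable_maxr => //; exact: measurable_minr. Qed.

Lemma measurable_node k : (k <= n)%N ->
  measurable_fun setT (fun x : n.-tuple R => node x k).
Proof.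
move=> kn; apply: (measurableT_comp measurable_clip); case: k kn => [|i] ik //=.
apply: (eq_measurable_fun (fun x : n.-tuple R => tnth x (Ordinal ik))).
  by move=> x _; rewrite (tnth_nth 0).
exact: measurable_tnth.
Qed.

Lemma measurable_theta_hat lam : measurable_fun setT (theta_hat lam).
Proof.
apply: measurable_sum => k; apply: measurable_funM.
  apply: measurableT_comp; first exact: measurable_expR.
  apply: measurable_funB.
    by apply: measurable_funM => //; exact: measurable_excess.
  apply: measurableT_comp; first exact: measurable_ln.
  apply: measurable_sum => j.
  apply: measurableT_comp; first exact: measurable_expR.
  by apply: measurable_funM => //; exact: measurable_excess.
have kn : (k <= n)%N by rewrite -ltnS.
apply: (measurableT_comp (measurable_node kn)
  (g := fun z : n.-tuple (R * R) => [tuple of [seq p.1 | p <- z]])).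
apply/measurable_fun_tnthP => i /=.
apply: (eq_measurable_fun (fun z : n.-tuple (R * R) => (tnth z i).1)).
  by move=> z _ /=; rewrite tnth_map.
exact: (measurableT_comp measurable_fst (measurable_tnth i)).
Qed.

End ExponentialWeights.

(** * Integrating out the noise *)

(* Contribution of the [i]-th noise variable to the ratio of the weights of [k]
   and [l], where [l] is the number of design points in the true segment. *)
Definition tilt {R : realType} (lam : R) (k l i : nat) (y : R) : R :=
  if (l <= i < k)%N then expR (lam * (y - 2^-1))
  else if (k <= i < l)%N then expR (- lam * (y + 2^-1)) else 1.

(** Only observations with index between [k] and [l] survive in the difference of the two sums.
    Indices below [l] have regression value 1 and the others 0, which gives the shifts by 1/2 in
    [tilt]. *)
Lemma expR_excess_observations {d} {T : measurableType d} {R : realType}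
    (P : probability T R) {n : nat} (X : {RV P >-> n.-tuple R})
    (xi : 'I_n -> {RV P >-> R}) (lam theta : R) (k : nat) (w : T) :
  sorted <=%R (X w) -> (forall i, 0 <= tnth (X w) i) ->
  let z := observations X xi `[0, theta] w in
  let l := ncount (X w) theta in
  expR (lam * (excess z k - excess z l)) = \prod_(i < n) tilt lam k l i (xi i w).
Proof.
move=> srt X0 z l.
rewrite /excess [X in X - _]big_mkcond [X in _ - X]big_mkcond -sumrB mulr_sumr.
rewrite expR_sum; apply: eq_bigr => i _; rewrite /tilt.
(* Sortedness turns membership in the segment into [i < l]; nonnegativity of the points settles the
   left endpoint. *)
have zi : (tnth z i).2 = (i < l)%N%:R + xi i w.
  rewrite /z /observations tnth_mktuple/= indicE; congr (_%:R + _); congr nat_of_bool.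
  apply/idP/idP => [/set_mem/=|il].
    rewrite in_itv/= => /andP[_]; rewrite (tnth_nth 0) ltnNge => xt.
    apply/negP => li; have := nth_count_gt 0 srt (x := theta) (i := i).
    by rewrite -/(ncount _ _) -/l li size_tuple ltn_ord ltNge xt => /(_ erefl).
  apply/mem_set; rewrite /= in_itv/= X0/= (tnth_nth 0).
  exact: (nth_count_le 0 srt).
rewrite zi; have [ik|ki] := ltnP i k; have [il|li] := ltnP i l;
  rewrite ?andbF ?andbT /=.
- by rewrite subrr mulr0 expR0.
- by rewrite add0r subr0.
- by congr expR; field.
- by rewrite subrr mulr0 expR0.
Qed.

Lemma tilt_ge0 (R : realType) (lam : R) (k l i : nat) (y : R) :
  0 <= tilt lam k l i y.
Proof. by rewrite /tilt; do 2?[case: ifP => _]; rewrite ?expR_ge0. Qed.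

Lemma measurable_tilt (R : realType) (lam : R) (k l i : nat) :
  measurable_fun setT (tilt lam k l i).
Proof.
rewrite /tilt; case: (_ <= _ < _)%N.
  apply: measurableT_comp; first exact: measurable_expR.
  by apply: measurable_funM => //; exact: measurable_funB.
case: (_ <= _ < _)%N => //.
apply: measurableT_comp; first exact: measurable_expR.
by apply: measurable_funM => //; exact: measurable_funD.
Qed.

(** The drift contributes [- lam / 2] to the exponent and the subgaussian bound
    [sigma ^+ 2 * lam ^+ 2 / 2]. The chosen [lam] minimises the sum, and the minimum is
    [- (8 * sigma ^+ 2)^-1]. The bound depends on [u] only through its square, so [key] serves both
    signs. *)
Lemma integral_tilt_le {d} {T : measurableType d} {R : realType}
    (P : probability T R) (sigma : R) (Z : {RV P >-> R}) (k l i : nat) :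
  0 < sigma -> subgaussian sigma Z ->
  (\int[P]_w (tilt (2 * sigma ^+ 2)^-1 k l i (Z w))%:E <=
   (if (l <= i < k)%N || (k <= i < l)%N then expR (- (8 * sigma ^+ 2)^-1) else 1)%:E)%E.
Proof.
move=> s0 sub; set lam := (2 * sigma ^+ 2)^-1.
have key u : u ^+ 2 = lam ^+ 2 ->
    (\int[P]_w (expR (- lam / 2) * expR (u * Z w))%:E <=
      (expR (- (8 * sigma ^+ 2)^-1))%:E)%E.
  move=> ul; under eq_integral do rewrite EFinM.
  rewrite ge0_integralZl_EFin ?expR_ge0//; last first.
    apply/measurable_EFinP/measurableT_comp; first exact: measurable_expR.
    by apply: measurable_funM => //; exact: measurable_funP.
  have := sub u; rewrite unlock => subu.
  apply: (@le_trans _ _ ((expR (- lam / 2))%:E *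
      (expR (sigma ^+ 2 * u ^+ 2 / 2))%:E)%E).
    by apply: lee_wpmul2l; rewrite ?lee_fin ?expR_ge0.
  rewrite -EFinM -expRD ul lee_fin ler_expR /lam le_eqVlt; apply/orP; left.
  by apply/eqP; field; rewrite gt_eqF.
rewrite /tilt; case: (l <= i < k)%N => /=.
  apply: le_trans (key lam erefl); rewrite le_eqVlt; apply/orP; left; apply/eqP.
  by apply: eq_integral => w _; rewrite -expRD; congr (expR _)%:E; field.
case: (k <= i < l)%N => /=.
  apply: le_trans (key (- lam) (sqrrN _)); rewrite le_eqVlt; apply/orP; left; apply/eqP.
  by apply: eq_integral => w _; rewrite -expRD; congr (expR _)%:E; field.
by rewrite integral_cst// mul1e probability_le1.
Qed.

Lemma prod_between (R : comRingType) (r : R) (n k l : nat) :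
  (k <= n)%N -> (l <= n)%N ->
  \prod_(i < n) (if (l <= i < k)%N || (k <= i < l)%N then r else 1) =
  r ^+ ((k - l) + (l - k)).
Proof.
move=> kn ln; rewrite -big_mkcond/= prodr_const; congr (_ ^+ _).
wlog lk : k l kn ln / (l <= k)%N => [H|].
  have [lk|/ltnW kl] := leqP l k; first exact: H.
  rewrite addnC -(H l k)//; apply: eq_card => i.
  by rewrite !unfold_in orbC.
rewrite -sum1_card.
rewrite (eq_bigl (fun i : 'I_n => (l <= i < k)%N)); last first.
  by move=> i; rewrite unfold_in; lia.
rewrite -(big_mkord (fun i => (l <= i < k)%N) (fun=> 1%N)) -big_filter.
have -> : (l - k = 0)%N by lia.
rewrite addn0 -[RHS](size_iota l) -sum1_size; apply: perm_big.
apply: uniq_perm; rewrite ?filter_uniq ?iota_uniq//.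
by move=> i; rewrite mem_filter !mem_index_iota; lia.
Qed.

Lemma integral_prod_tilt_le {d} {T : measurableType d} {R : realType}
    (P : probability T R) (sigma : R) {n : nat} (xi : 'I_n -> {RV P >-> R})
    (k l : nat) :
  0 < sigma -> mutually_independent xi -> (forall i, subgaussian sigma (xi i)) ->
  (k <= n)%N -> (l <= n)%N ->
  (\int[P]_w (\prod_(i < n) tilt (2 * sigma ^+ 2)^-1 k l i (xi i w))%:E <=
   (expR (- (8 * sigma ^+ 2)^-1) ^+ ((k - l) + (l - k)))%:E)%E.
Proof.
move=> s0 indxi sub kn ln; set lam := (2 * _)^-1; set r := expR _.
pose I (i : 'I_n) := (\int[P]_w (tilt lam k l i (xi i w))%:E)%E.
have Ile (i : 'I_n) : (I i <= (if (l <= i < k)%N || (k <= i < l)%N then r else 1)%:E)%E.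
  exact: integral_tilt_le.
have I0 i : (0 <= I i)%E.
  by apply: integral_ge0 => w _; rewrite lee_fin tilt_ge0.
have Ifin i : I i \is a fin_num.
  by rewrite ge0_fin_numE// (le_lt_trans (Ile i))// ltry.
rewrite (@integral_prod_independent _ _ _ _ _ xi (fun i => tilt lam k l i)
  (fun i => fine (I i)))//.
- rewrite lee_fin -(prod_between _ kn ln); apply: ler_prod => i _.
  by rewrite fine_ge0//= -lee_fin fineK.
- by move=> i; exact: measurable_tilt.
- by move=> i y; exact: tilt_ge0.
- by move=> i; rewrite fineK.
Qed.

Lemma measurable_ncount_eq (R : realType) (n : nat) (theta : R) (l : nat) :
  measurable [set x : n.-tuple R | ncount x theta = l].
Proof.
have countE (x : n.-tuple R) :
    \sum_(i < n) \1_`]-oo, theta] (tnth x i) = (ncount x theta)%:R :> R.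
  rewrite /ncount -sum1_count big_tuple [in RHS]big_mkcond natr_sum.
  by apply: eq_bigr => i _; rewrite indicE mem_setE in_itv/=; case: ifP.
have -> : [set x : n.-tuple R | ncount x theta = l] =
    (fun x : n.-tuple R => \sum_(i < n) \1_`]-oo, theta] (tnth x i)) @^-1` [set l%:R : R].
  apply/seteqP; split => x /=; rewrite countE; first by move=> ->.
  by move=> /eqP; rewrite eqr_nat => /eqP.
rewrite -[X in measurable X]setTI.
suff H : measurable_fun setT
  (fun x : n.-tuple R => \sum_(i < n) \1_`]-oo, theta] (tnth x i) : R) by exact: H.
apply: measurable_sum => i.
have mi : measurable_fun setT (\1_`]-oo, theta] : R -> R) by exact: measurable_indic.
exact: (measurableT_comp mi (measurable_tnth i)).
Qed.

Lemma measurable_observations {d} {T : measurableType d} {R : realType}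
    (P : probability T R) {n : nat} (X : {RV P >-> n.-tuple R})
    (xi : 'I_n -> {RV P >-> R}) (G : set R) :
  measurable G -> measurable_fun setT (observations X xi G).
Proof.
move=> mG; apply/measurable_fun_tnthP => i.
have mX : measurable_fun setT (fun w => tnth (X w) i).
  exact: (measurableT_comp (measurable_tnth i)).
apply: (eq_measurable_fun
  (fun w => (tnth (X w) i, \1_G (tnth (X w) i) + xi i w))).
  by move=> w _ /=; rewrite tnth_mktuple.
apply: measurable_fun_pair => //; apply: measurable_funD; last exact: measurable_funP.
by apply: measurableT_comp mX => //; exact: measurable_indic.
Qed.

Lemma fst_observations {d} {T : measurableType d} {R : realType}
    (P : probability T R) {n : nat} (X : {RV P >-> n.-tuple R})
    (xi : 'I_n -> {RV P >-> R}) (G : set R) (w : T) :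
  [seq p.1 | p <- observations X xi G w] = X w.
Proof.
rewrite -[RHS](map_tnth_enum (X w)) -map_comp.
by apply: eq_map => i.
Qed.

(** Splits according to the random count, so that in each term the index [l] is a constant. *)
Lemma sum_indic_ncount (R : realType) (n : nat) (x : n.-tuple R) (theta : R)
    (F : nat -> R) :
  F (ncount x theta) = \sum_(l < n.+1)
    \1_[set x : n.-tuple R | ncount x theta = l] x * F l.
Proof.
have Kn : (ncount x theta < n.+1)%N.
  by rewrite ltnS -[leqRHS](size_tuple x) count_size.
rewrite (bigD1 (Ordinal Kn))//= indicE mem_set// mul1r big1 ?addr0// => l lK.
rewrite indicE memNset ?mul0r// => /= H.
by move/eqP: lK; apply; apply: val_inj.
Qed.

(** Both sides are expanded over the value [l] of the count and compared term by term. For fixed [k]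
    and [l] a term is a function [f] of the design times a function [g] of the noise; independence
    factors the integral, and the mean of [g] is at most the power of [r]. *)
Lemma integral_theta_hat_dist_le {d} {T : measurableType d} {R : realType}
    (P : probability T R) (sigma : R) {n : nat} (X : {RV P >-> n.-tuple R})
    (xi : 'I_n -> {RV P >-> R}) (theta : R) :
  0 < sigma -> noise_model sigma X xi ->
  (forall w, sorted <=%R (X w)) ->
  {ae P, forall w, forall i, 0 <= tnth (X w) i} ->
  0 <= theta <= 1 ->
  (\int[P]_w (`|theta_hat (2 * sigma ^+ 2)^-1
                 (observations X xi `[0%R, theta] w) - theta|)%:E <=
   \int[P]_w (\sum_(k < n.+1) `|node (X w) k - theta| *
      expR (- (8 * sigma ^+ 2)^-1) ^+
        ((k - ncount (X w) theta) + (ncount (X w) theta - k)))%:E)%E.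
Proof.
move=> s0 [indxi _ sub indX] srt X0 /andP[t0 t1].
set lam := (2 * _)^-1; set r := expR _.
have r0 : 0 <= r by exact: expR_ge0.
pose S (l : nat) := [set x : n.-tuple R | ncount x theta = l].
pose f (k l : nat) (x : n.-tuple R) := \1_(S l) x * `|node x k - theta|.
pose g (k l : nat) (y : n.-tuple R) := \prod_(i < n) tilt lam k l i (tnth y i).
pose W w := [tuple xi i w | i < n].
have f0 k l x : 0 <= f k l x by rewrite mulr_ge0.
have g0 k l y : 0 <= g k l y by apply: prodr_ge0 => i _; exact: tilt_ge0.
have mf (k l : 'I_n.+1) : measurable_fun setT (f k l).
  apply: measurable_funM; first by apply: measurable_indic; exact: measurable_ncount_eq.
  apply: measurableT_comp; first exact: normr_measurable.
  apply: measurable_funB => //; apply: measurable_node; by rewrite -ltnS.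
have mg k l : measurable_fun setT (g k l).
  apply: measurable_prod => i _.
  exact: (measurableT_comp (measurable_tilt lam k l i) (measurable_tnth i)).
have mX : measurable_fun setT X by exact: measurable_funP.
have mW : measurable_fun setT W.
  apply/measurable_fun_tnthP => i.
  apply: (eq_measurable_fun (xi i)); first by move=> w _ /=; rewrite tnth_mktuple.
  exact: measurable_funP.
have mfX (k l : 'I_n.+1) : measurable_fun setT (fun w => f k l (X w)).
  exact: (measurableT_comp (mf k l) mX).
have mgW k l : measurable_fun setT (fun w => g k l (W w)).
  exact: (measurableT_comp (mg k l) mW).
(* The factorization takes the mean of [f] as a real number, so it has to be finite; [f] is at most
   1 because nodes and [theta] lie in [[0, 1]]. *)
have ffin (k l : 'I_n.+1) : (\int[P]_w (f k l (X w))%:E)%E \is a fin_num.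
  rewrite ge0_fin_numE; last by apply: integral_ge0 => w _; rewrite lee_fin.
  apply: (@le_lt_trans _ _ (\int[P]_w (cst 1%:E w))%E).
    apply: ge0_le_integral => //; first by move=> w _; rewrite lee_fin.
    - exact/measurable_EFinP.
    - move=> w _; rewrite /= lee_fin /f.
      have /andP[c0 c1] := clip_itv (nth 0 (0 :: X w) k).
      rewrite -/(node (X w) k) in c0 c1.
      rewrite -[leRHS]mulr1 ler_pM//.
      by rewrite ler_norml; apply/andP; split; lra.
  by rewrite integral_cst// mul1e (le_lt_trans (probability_le1 P _))// ltry.
apply: (@le_trans _ _ (\int[P]_w (\sum_(k < n.+1) \sum_(l < n.+1)
    f k l (X w) * g k l (W w))%:E)%E).
  (* The product formula for the weights is available only where all points are nonnegative, hence
     an almost everywhere comparison. *)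
  apply: ae_ge0_le_integral => //.
  - apply/measurable_EFinP; apply: measurableT_comp; first exact: normr_measurable.
    apply: measurable_funB => //.
    apply: (measurableT_comp (measurable_theta_hat lam)).
    exact: measurable_observations.
  - move=> w _; rewrite lee_fin; apply: sumr_ge0 => k _; apply: sumr_ge0 => l _.
    by rewrite mulr_ge0.
  - apply/measurable_EFinP; apply: measurable_sum => k; apply: measurable_sum => l.
    exact: measurable_funM.
  have := X0; apply: filterS => w Xw0 _; rewrite lee_fin.
  have Kn : (ncount (X w) theta < n.+1)%N.
    by rewrite ltnS -[leqRHS](size_tuple (X w)) count_size.
  apply: (le_trans (theta_hat_dist_le _ _ _ (Ordinal Kn))).
  rewrite fst_observations; apply: ler_sum => k _ /=.
  rewrite expR_excess_observations//.
  rewrite (sum_indic_ncount (X w) theta (fun l => `|node (X w) k - theta| *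
    \prod_(i < n) tilt lam k l i (xi i w))).
  rewrite le_eqVlt; apply/orP; left; apply/eqP; apply: eq_bigr => l _.
  rewrite mulrA; congr (_ * _); apply: eq_bigr => i _.
  by rewrite tnth_mktuple.
under eq_integral do rewrite -sumEFin; rewrite ge0_integral_sum//; last 2 first.
- move=> k; apply/measurable_EFinP; apply: measurable_sum => l; exact: measurable_funM.
- move=> k w _; rewrite lee_fin; apply: sumr_ge0 => l _; exact: mulr_ge0.
have mR (k l : 'I_n.+1) :
    measurable_fun setT (fun w => f k l (X w) * r ^+ ((k - l) + (l - k))).
  exact: measurable_funM.
have -> : (\int[P]_w (\sum_(k < n.+1) `|node (X w) k - theta| *
      r ^+ ((k - ncount (X w) theta) + (ncount (X w) theta - k)))%:E =
    \int[P]_w \sum_(k < n.+1) (\sum_(l < n.+1)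
      f k l (X w) * r ^+ ((k - l) + (l - k)))%:E)%E.
  apply: eq_integral => w _; rewrite sumEFin; congr (_%:E); apply: eq_bigr => k _.
  rewrite (sum_indic_ncount (X w) theta (fun l => `|node (X w) k - theta| *
    r ^+ ((k - l) + (l - k)))).
  by apply: eq_bigr => l _; rewrite mulrA.
rewrite ge0_integral_sum//; last 2 first.
- move=> k; apply/measurable_EFinP; exact: measurable_sum.
- move=> k w _; rewrite lee_fin; apply: sumr_ge0 => l _; by rewrite mulr_ge0 ?exprn_ge0.
apply: lee_sum => k _.
under eq_integral do rewrite -sumEFin; rewrite ge0_integral_sum//; last 2 first.
- move=> l; apply/measurable_EFinP; exact: measurable_funM.
- by move=> l w _; rewrite lee_fin mulr_ge0.
under [leRHS]eq_integral do rewrite -sumEFin; rewrite ge0_integral_sum//; last 2 first.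
- move=> l; apply/measurable_EFinP; exact: mR.
- by move=> l w _; rewrite lee_fin mulr_ge0 ?exprn_ge0.
apply: lee_sum => l _.
rewrite (integral_mul_independent_vectors (a := fine (\int[P]_w (f k l (X w))%:E)) indX)//;
  last by rewrite fineK.
under [leRHS]eq_integral do rewrite EFinM muleC.
rewrite ge0_integralZl_EFin ?exprn_ge0//; last 2 first.
- by move=> w _; rewrite lee_fin.
- exact/measurable_EFinP.
rewrite fineK// muleC; apply: lee_wpmul2r.
  by apply: integral_ge0 => w _; rewrite lee_fin.
have -> : (\int[P]_w (g k l (W w))%:E =
    \int[P]_w (\prod_(i < n) tilt lam k l i (xi i w))%:E)%E.
  apply: eq_integral => w _; congr (_%:E); apply: eq_bigr => i _.
  by rewrite tnth_mktuple.
by apply: integral_prod_tilt_le => //; rewrite -ltnS.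
Qed.

(** * Properties shared by the two designs *)

Lemma sorted_design {d} {T : measurableType d} {R : realType}
    (P : probability T R) {n : nat} (X : {RV P >-> n.-tuple R}) (w : T) :
  deterministic_design X \/ random_design X -> sorted <=%R (X w).
Proof.
case=> [dd|[U [_ _ ->]]]; last by rewrite /= sort_sorted//; exact: le_total.
apply/(sortedP 0) => i; rewrite size_tuple => iltn.
have := dd w (Ordinal iltn); have := dd w (Ordinal (ltnW iltn)).
rewrite !(tnth_nth 0)/= => -> ->.
by rewrite ler_pM2r ?ler_nat// invr_gt0 ltr0n (leq_ltn_trans (leq0n i.+1)).
Qed.

Section CommonMarginal.
Context {d} {T : measurableType d} {R : realType} (P : probability T R) {n : nat}.
Variables (Z : 'I_n -> {RV P >-> R}) (A : set R) (a : R).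
Hypotheses (indZ : mutually_independent Z) (mA : measurable A).
Hypothesis PA : forall i, P (Z i @^-1` A) = a%:E.

Lemma probability_forall_independent :
  measurable [set w | forall i, A (Z i w)] /\
  P [set w | forall i, A (Z i w)] = (a ^+ n)%:E.
Proof.
have -> : [set w | forall i, A (Z i w)] =
    \bigcap_(i in [set` [set: 'I_n]%SET]) (Z i @^-1` A).
  by apply/seteqP; split => w /= H i; [move=> _; exact: H|apply: H; rewrite /= inE].
split.
  apply: fin_bigcap_measurable => // i _.
  by rewrite -[X in measurable X]setTI; exact: measurable_funP.
rewrite indZ//; under eq_bigr do rewrite PA.
by rewrite prodEFin prodr_const cardsT card_ord.
Qed.

(** The generating function of a binomial count: each factor has mean [r * a + (1 - a)]. *)
Lemma integral_expr_count_independent (r : R) : 0 <= r ->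
  (\int[P]_w (\prod_(i < n) (if Z i w \in A then r else 1))%:E =
   ((1 - (1 - r) * a) ^+ n)%:E)%E.
Proof.
move=> r0.
have ifE y : (if y \in A then r else 1) = r * \1_A y + \1_(~` A) y.
  by rewrite !indicE in_setC; case: (_ \in A); rewrite ?mulr1 ?mulr0 ?addr0 ?add0r.
have mAC : measurable (~` A) by exact: measurableC.
have mind B : measurable B -> measurable_fun setT (\1_B : R -> R).
  by move=> mB; exact: measurable_indic.
rewrite (@integral_prod_independent _ _ _ _ _ Z
  (fun _ y => if y \in A then r else 1) (fun=> 1 - (1 - r) * a))//.
- by rewrite prodr_const card_ord.
- move=> _; under eq_fun do rewrite ifE.
  by apply: measurable_funD; [apply: measurable_funM|]; rewrite //; exact: mind.
- by move=> _ y; case: ifP.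
move=> i.
transitivity (\int[P]_w ((r%:E * (\1_A (Z i w))%:E) + (\1_(~` A) (Z i w))%:E))%E.
  by apply: eq_integral => w _; rewrite ifE EFinD EFinM.
have mI B : measurable B -> measurable_fun setT (fun w => (\1_B (Z i w))%:E : \bar R).
  move=> mB; apply/measurable_EFinP.
  by apply: measurableT_comp => //; exact: mind.
have mZA : measurable (Z i @^-1` A).
  by rewrite -[X in measurable X]setTI; exact: measurable_funP.
have p1 w : (0 <= r%:E * (\1_A (Z i w))%:E)%E by rewrite -EFinM lee_fin mulr_ge0.
have p2 B w : (0 <= (\1_B (Z i w))%:E :> \bar R)%E by rewrite lee_fin.
have m1 : measurable_fun setT (fun w => r%:E * (\1_A (Z i w))%:E)%E.
  by apply: measurable_funeM; exact: mI.
rewrite (ge0_integralD _ _ (fun w _ => p1 w) m1 (fun w _ => p2 (~` A) w) (mI _ mAC))//.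
rewrite (ge0_integralZl_EFin _ _ (fun w _ => p2 A w) (mI _ mA) r0)//.
rewrite !integral_indic_comp// preimage_setC probability_setC// PA.
by rewrite -EFinM -EFinB -EFinD; congr (_%:E); ring.
Qed.

End CommonMarginal.

Lemma uniform_prob_subset01 (R : realType) (A : set R) : measurable A ->
  A `<=` `[0, 1] -> uniform_prob (@ltr01 R) A = lebesgue_measure A.
Proof.
move=> mA A01; rewrite /uniform_prob.
rewrite (eq_integral (cst 1%:E)); first by rewrite integral_cst// mul1e.
move=> x; rewrite inE => /A01; rewrite /= in_itv/= => x01.
by rewrite /uniform_pdf x01 subr0 invr1.
Qed.

(** Uniform variables lie in [[0, 1]] up to a null set, and each order statistic is one of them. *)
Lemma design_ge0 {d} {T : measurableType d} {R : realType}
    (P : probability T R) {n : nat} (X : {RV P >-> n.-tuple R}) :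
  deterministic_design X \/ random_design X ->
  {ae P, forall w, forall i, 0 <= tnth (X w) i}.
Proof.
case=> [dd|[U [indU unifU XU]]].
  by apply: aeW => w i; rewrite dd divr_ge0.
have P01 i : P (U i @^-1` `[0, 1]) = 1%:E.
  have := unifU i `[0, 1]%classic (measurable_itv _); rewrite /distribution /pushforward => ->.
  by rewrite uniform_prob_subset01// lebesgue_measure_itv/= lte_fin ltr01 sube0.
have [mE PE] := probability_forall_independent indU (measurable_itv _) P01.
exists (~` [set w | forall i, `[0, 1]%classic (U i w)]); split.
- exact: measurableC.
- by rewrite probability_setC// PE expr1n subee.
apply: subsetC => w /= Uw i; rewrite XU.
have : tnth [tuple of sort <=%R [tuple U i w | i < n]] i \in
    sort <=%R [tuple U i w | i < n] by exact: mem_tnth.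
rewrite mem_sort => /tnthP[j ->]; rewrite tnth_mktuple.
by have := Uw j; rewrite /= in_itv/= => /andP[].
Qed.

Lemma ncount_split (R : realDomainType) (x : seq R) (s t : R) : s <= t ->
  (ncount x t - ncount x s)%N = count (fun y => (s < y <= t)%R) x.
Proof.
move=> st; suff -> : ncount x t = (ncount x s + count (fun y => (s < y <= t)%R) x)%N.
  by rewrite addKn.
rewrite /ncount; elim: x => //= y x ->.
have [ys|sy] := leP y s => /=; last by rewrite add0n addnCA.
by rewrite (le_trans ys st) add0n addnA.
Qed.

Lemma measurable_ncount2 (R : realType) (n : nat) (s t : R) (F : nat -> nat -> R) :
  measurable_fun setT (fun x : n.-tuple R => F (ncount x s) (ncount x t)).
Proof.
under eq_fun => x do rewrite (sum_indic_ncount x s (fun l => F l (ncount x t))).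
apply: measurable_sum => l; apply: measurable_funM.
  by apply: measurable_indic; exact: measurable_ncount_eq.
under eq_fun => x do rewrite (sum_indic_ncount x t (fun m => F l m)).
apply: measurable_sum => m; apply: measurable_funM => //.
by apply: measurable_indic; exact: measurable_ncount_eq.
Qed.

(** For the random design the exponent is binomial with success probability [j / n], and
    [1 - x <= exp (- x)] bounds its generating function. For the grid the interval contains at least
    [j] points, and [r <= exp (- (1 - r))] by the same inequality. *)
Lemma integral_expr_ncount_le {d} {T : measurableType d} {R : realType}
    (P : probability T R) {n : nat} (X : {RV P >-> n.-tuple R}) (r s : R) (j : nat) :
  (0 < n)%N -> deterministic_design X \/ random_design X ->
  0 <= r <= 1 -> 0 <= s -> s + j%:R / n%:R <= 1 ->
  (\int[P]_w (r ^+ (ncount (X w) (s + j%:R / n%:R)%R - ncount (X w) s))%:E <=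
    (expR (- (1 - r)) ^+ j)%:E)%E.
Proof.
move=> n0 design /andP[r0 r1] s0 st; set t := s + _ in st *.
have nR0 : 0 < n%:R :> R by rewrite ltr0n.
have lest : s <= t by rewrite lerDl divr_ge0.
case: (design) => [dd|[U [indU unifU XU]]]; last first.
  have PI i : P (U i @^-1` `]s, t]) = (j%:R / n%:R)%:E.
    have := unifU i `]s, t]%classic (measurable_itv _); rewrite /distribution /pushforward => ->.
    rewrite uniform_prob_subset01//; last first.
      move=> y /=; rewrite !in_itv/= => /andP[sy yt].
      by rewrite (le_trans s0 (ltW sy)) (le_trans yt st).
    rewrite lebesgue_measure_itv/= lte_fin -EFinB.
    case: ltP => [_|ts]; first by rewrite /t addrC addKr.
    by congr (_%:E); have := le_anti (introT andP (conj lest ts)); rewrite /t; lra.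
  have -> : (\int[P]_w (r ^+ (ncount (X w) t - ncount (X w) s))%:E =
      \int[P]_w (\prod_(i < n) (if U i w \in `]s, t]%classic then r else 1))%:E)%E.
    apply: eq_integral => w _; congr (_%:E).
    rewrite ncount_split// XU/= (permP (permEl (perm_sort _ _))).
    rewrite -big_mkcond/= prodr_const -sum1_count big_map/= big_enum_cond/=.
    rewrite sum1_card; congr (_ ^+ _); apply: eq_card => i.
    by rewrite !unfold_in asboolb -[RHS]/(_ \in `]s, t]) in_itv.
  rewrite (integral_expr_count_independent indU (measurable_itv _) PI)//.
  rewrite lee_fin.
  have -> : expR (- (1 - r)) ^+ j = expR (- ((1 - r) * (j%:R / n%:R))) ^+ n.
    rewrite -!expRM_natr; congr expR; field; by rewrite gt_eqF.
  apply: lerXn2r; rewrite ?nnegrE ?expR_ge0//; last exact: expR_ge1Dx.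
  have jn1 : j%:R / n%:R <= 1 :> R by rewrite (le_trans _ st)// lerDr.
  have jn0 : 0 <= j%:R / n%:R :> R by rewrite divr_ge0.
  by rewrite subr_ge0 mulr_ile1//; lra.
have rr : r <= expR (- (1 - r)).
  by rewrite (le_trans _ (expR_ge1Dx _))// opprB addrC subrK.
apply: (@le_trans _ _ (\int[P]_w (cst (expR (- (1 - r)) ^+ j)%:E w))%E); last first.
  by rewrite integral_cst// -[leRHS]mule1 lee_wpmul2l ?probability_le1// lee_fin exprn_ge0// expR_ge0.
apply: ge0_le_integral => //.
- by move=> w _; rewrite lee_fin exprn_ge0.
- apply/measurable_EFinP.
  apply: (measurableT_comp (measurable_ncount2 s t (fun l m => r ^+ (m - l)))).
  exact: measurable_funP.
move=> w _ /=; rewrite lee_fin; apply: (@le_trans _ _ (r ^+ j)); last first.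
  by apply: lerXn2r; rewrite ?nnegrE ?expR_ge0.
suff jK : (j <= ncount (X w) t - ncount (X w) s)%N.
  by rewrite -(subnKC jK) exprD ler_piMr ?exprn_ge0// exprn_ile1.
have srt := sorted_design w design.
have an : (ncount (X w) s <= n)%N by rewrite -[leqRHS](size_tuple (X w)) count_size.
have Xnth i (ilt : (i < n)%N) : nth 0 (X w) i = i.+1%:R / n%:R.
  by rewrite -(dd w (Ordinal ilt)) (tnth_nth 0).
have as_ : (ncount (X w) s)%:R / n%:R <= s.
  case a : (ncount (X w) s) an => [|b] bn; first by rewrite mul0r.
  by rewrite -Xnth// (nth_count_le 0 srt)// -/(ncount _ _) a.
(* If [a] grid points are at most [s], then [a / n <= s], so [(a + j) / n] is at most [t] and, as
   [t <= 1], is itself a grid point or 0. *)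
rewrite leq_subRL; last by apply: sub_count => y /= /le_trans; exact.
have at_ : (ncount (X w) s + j)%:R / n%:R <= t.
  by rewrite natrD mulrDl lerD2r.
have ajn : (ncount (X w) s + j <= n)%N.
  by have := le_trans at_ st; rewrite ler_pdivrMr// mul1r ler_nat.
(* The grid point [(a + j) / n] sits at index [a + j - 1], hence the case split. *)
case a : (ncount (X w) s + j)%N at_ ajn => [//|b] at_ bn.
rewrite ltnNge; apply/negP => Kb; move: at_; rewrite -Xnth//.
by rewrite leNgt (nth_count_gt 0 srt)// size_tuple bn andbT.
Qed.

(** * Measurability of the loss, and the lower bound *)

(** The symmetric differences are the sections of one measurable subset of [T * R], and the measure
    of a section is a measurable function. *)
Lemma measurable_symdiff_itv {d} {T : measurableType d} {R : realType}
    (G : set R) (a b : T -> R) :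
  measurable G -> measurable_fun setT a -> measurable_fun setT b ->
  measurable_fun setT (fun w => @lebesgue_measure R (G `+` `[a w, b w])).
Proof.
move=> mG ma mb.
pose I := [set p : T * R | a p.1 <= p.2] `&` [set p | p.2 <= b p.1].
have mI : measurable I.
  apply: measurableI; rewrite -[X in measurable X]setTI.
    apply: measurable_fun_le => //; first exact: (measurableT_comp ma measurable_fst).
  apply: measurable_fun_le => //; first exact: (measurableT_comp mb measurable_fst).
have mTG : measurable ([set: T] `*` G) by exact: measurableX.
pose A := ([set: T] `*` G) `+` I.
have mA : measurable A by apply: measurableU; exact: measurableD.
apply: (eq_measurable_fun (@lebesgue_measure R \o xsection A)); last first.
  exact: measurable_fun_xsection.
move=> w _ /=; congr (lebesgue_measure _).
have abE x : is_true (a w <= x <= b w) = (a w <= x /\ x <= b w).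
  by apply/propext; split => /andP.
by apply/seteqP; split => x; rewrite /xsection /= inE /A /I /setY /= in_itv/= abE; tauto.
Qed.

(** Bernoulli's inequality. *)
Lemma one_sub_mul_le_expr (R : realDomainType) (x : R) (n : nat) :
  0 <= x <= 1 -> 1 - n%:R * x <= (1 - x) ^+ n.
Proof.
move=> /andP[x0 x1]; elim: n => [|n IH]; first by rewrite mul0r subr0.
rewrite exprS -natr1; have : 0 <= n%:R :> R by [].
have : (1 - n%:R * x) * (1 - x) <= (1 - x) ^+ n * (1 - x).
  by rewrite ler_wpM2r// subr_ge0.
set y := _ ^+ n; set m : R := n%:R; have : 0 <= x * x by rewrite mulr_ge0.
nra.
Qed.

(** The grid starts at [1/n], beyond [1/(2n)]. For the random design, [n] independent points all
    avoid the interval with probability [(1 - 1/(2n))^n], at least 1/2 by Bernoulli's inequality. *)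
Lemma design_avoids {d} {T : measurableType d} {R : realType}
    (P : probability T R) {n : nat} (X : {RV P >-> n.-tuple R}) :
  (0 < n)%N -> deterministic_design X \/ random_design X ->
  exists E : set T, [/\ measurable E, (2^-1%:E <= P E)%E &
    forall w, E w -> forall i, ~ `[0, (2 * n%:R)^-1]%classic (tnth (X w) i)].
Proof.
move=> n0; have nR0 : 0 < n%:R :> R by rewrite ltr0n.
have n1 : 1 <= n%:R :> R by rewrite ler1n.
set u := (2 * n%:R)^-1.
have u0 : 0 <= u by rewrite invr_ge0 mulr_ge0.
have u1 : u <= 1 by rewrite invf_le1; lra.
case=> [dd|[U [indU unifU XU]]].
  exists setT; split => //.
    by rewrite probability_setT lee_fin invf_le1// ler1n.
  move=> w _ i; rewrite dd /= in_itv/= => /andP[_].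
  apply/negP; rewrite -ltNge ltr_pdivlMr// /u invfM -mulrA mulVf ?gt_eqF// mulr1.
  by rewrite (@lt_le_trans _ _ 1) ?ler1n// invf_lt1// ltr1n.
pose I : set R := `[0, u]%classic.
have mI : measurable I by exact: measurable_itv.
have mA : measurable (~` I) by exact: measurableC.
have PA i : P (U i @^-1` (~` I)) = (1 - u)%:E.
  rewrite preimage_setC probability_setC; last first.
    by rewrite -[X in measurable X]setTI; exact: (measurable_funP (U i) measurableT I mI).
  have := unifU i I mI; rewrite /distribution /pushforward => ->.
  rewrite uniform_prob_subset01//; last first.
    by move=> y; rewrite /I /= !in_itv/= => /andP[-> /le_trans]; exact.
  rewrite lebesgue_measure_itv/= lte_fin; case: ltP => [_|u0'].
    by rewrite sube0 EFinB.
  by rewrite sube0 (le_anti (introT andP (conj u0' u0))) subr0.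
have [mE PE] := probability_forall_independent indU mA PA.
exists [set w | forall i, (~` I) (U i w)]; split => //.
  rewrite PE lee_fin (le_trans _ (one_sub_mul_le_expr (x := u) n _)) ?u0 ?u1//.
  have -> : n%:R * u = 2^-1 by rewrite /u; field; rewrite gt_eqF.
  by lra.
move=> w /= Uw i; rewrite XU.
have : tnth [tuple of sort <=%R [tuple U i w | i < n]] i \in
    sort <=%R [tuple U i w | i < n] by exact: mem_tnth.
by rewrite mem_sort => /tnthP[j ->]; rewrite tnth_mktuple; exact: Uw.
Qed.

(** On [E] the estimate is the same under both segments, so the two losses add up to at least
    [u = 1/(2n)]. As [E] has probability at least 1/2, the two risks add up to at least [u / 2];
    both are at most the worst-case risk, which is thus at least [u / 4 = 1/(8n)]. *)
Lemma minimax_risk_ge {d} {T : measurableType d} {R : realType}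
    (P : probability T R) {n : nat} (X : {RV P >-> n.-tuple R})
    (xi : 'I_n -> {RV P >-> R}) :
  (0 < n)%N -> deterministic_design X \/ random_design X ->
  ((8^-1 / n%:R)%:E <= minimax_risk X xi segments_from_0)%E.
Proof.
move=> n0 design; have nR0 : 0 < n%:R :> R by rewrite ltr0n.
have n1 : 1 <= n%:R :> R by rewrite ler1n.
have [E [mE PE EX]] := design_avoids n0 design.
set u := (2 * n%:R)^-1 in EX.
have u0 : 0 < u by rewrite invr_gt0 mulr_gt0.
have u1 : u <= 1 by rewrite invf_le1; lra.
apply: le_ereal_inf_tmp => _ [Ghat [a [b [ma mb ab GhatE]]] <-].
pose f t w := (@lebesgue_measure R
  (`[0%R, t] `+` Ghat (observations X xi `[0%R, t] w))).
have fr t : 0 <= t <= 1 -> (\int[P]_w f t w <= risk X xi Ghat segments_from_0)%E.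
  move=> t01; apply: ereal_sup_ubound; exists `[0%R, t]%classic => //.
  by exists t => //=; rewrite in_itv.
have mf t : measurable_fun setT (f t).
  rewrite /f; under eq_fun do rewrite GhatE.
  have mo : measurable_fun setT (observations X xi `[0%R, t]).
    exact: measurable_observations.
  apply: measurable_symdiff_itv => //; first exact: (measurableT_comp ma mo).
  exact: (measurableT_comp mb mo).
have f0 t w : (0 <= f t w)%E by exact: measure_ge0.
have fE w : E w -> (u%:E <= f 0%R w + f u w)%E.
  move=> Ew; rewrite /f.
  have -> : observations X xi `[0%R, 0] w = observations X xi `[0%R, u] w.
    apply: eq_from_tnth => i; rewrite !tnth_mktuple; congr (_, _ + _).
    rewrite !indicE !memNset//; first exact: EX.
    move=> H; apply: (EX w Ew i); move: H; rewrite /= !in_itv/= => /andP[-> /le_trans->//].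
    exact: ltW.
  rewrite GhatE; set z := observations _ _ _ _; set I := `[a z, b z]%classic.
  have mI : measurable I by exact: measurable_itv.
  have mY t : measurable (`[0%R, t] `+` I).
    by apply: measurableU; exact: measurableD.
  have := measureU2 (@lebesgue_measure R) (mY 0) (mY u); apply: le_trans.
  apply: (@le_trans _ _ (@lebesgue_measure R `]0%R, u])).
    by rewrite lebesgue_measure_itv/= lte_fin u0 sube0.
  apply: le_measure; rewrite ?inE; [exact: measurable_itv|by apply: measurableU; exact: mY|].
  move=> x /=; rewrite in_itv/= => /andP[x0 xu].
  (* A point of [(0, u]] in the estimate is an error for the segment reduced to 0; a point outside
     it is an error for [[0, u]]. *)
  have [Ix|Ix] := pselect (I x).
    left; right; split => //=; rewrite in_itv/= => /andP[_].
    by rewrite leNgt x0.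
  by right; left; split => //=; rewrite in_itv/= xu ltW.
set rk := risk _ _ _ _ in fr *.
have : ((u / 2)%:E <= rk + rk)%E.
  apply: (@le_trans _ _ (\int[P]_w (f 0%R w + f u w))%E); last first.
    rewrite ge0_integralD//; apply: leeD; apply: fr; first by rewrite lexx ler01.
    by rewrite u1 ltW.
  apply: (@le_trans _ _ (\int[P]_w (u%:E * (\1_E w)%:E))%E).
    rewrite ge0_integralZl_EFin//; first last.
    - exact: ltW.
    - by apply/measurable_EFinP; exact: measurable_indic.
    rewrite integral_indic// setIT EFinM; apply: lee_wpmul2l => //.
    by rewrite lee_fin ltW.
  apply: ge0_le_integral => //.
  - by move=> w _; rewrite -EFinM lee_fin mulr_ge0// ltW.
  - apply: measurable_funeM; apply/measurable_EFinP; exact: measurable_indic.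
  - exact: emeasurable_funD.
  move=> w _; rewrite indicE; have [/set_mem/fE|_] := boolP (w \in E).
    by rewrite mule1.
  by rewrite mule0 adde_ge0.
have -> : 8^-1 / n%:R = u / 2 / 2 by rewrite /u; field; rewrite gt_eqF.
case: rk {fr} => [x| _|]; last by rewrite leeNy_eq.
  by rewrite -EFinD !lee_fin; lra.
by rewrite leey.
Qed.

(** * The upper bound and the conclusion *)

Lemma lebesgue_measure_symdiff_itv0_le (R : realType) (s t : R) :
  0 <= s -> 0 <= t ->
  (@lebesgue_measure R (`[0%R, s] `+` `[0%R, t]) <= (`|t - s|)%:E)%E.
Proof.
move=> s0 t0.
have -> : (`|t - s|)%:E =
    @lebesgue_measure R `[Num.min s t, Num.max s t].
  rewrite lebesgue_measure_itv/= lte_fin -EFinB.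
  have [st|ts|->] := ltgtP s t; last by rewrite ltxx subrr normr0.
    by rewrite st gtr0_norm// subr_gt0.
  by rewrite ts ltr0_norm ?subr_lt0// opprB.
apply: le_measure; rewrite ?inE; [by apply: measurableU; exact: measurableD|exact: measurable_itv|].
move=> x; rewrite /setY /= !in_itv/= ge_min le_max.
move=> [[/andP[x0 xs] /negP]|[/andP[x0 xt] /negP]]; rewrite x0/= -ltNge => /ltW h.
  by rewrite h xs/= orbT.
by rewrite h xt/= orbT.
Qed.

Lemma sum_exprS_le (R : realFieldType) (r : R) (n : nat) :
  0 <= r < 1 -> \sum_(j < n) r ^+ j.+1 <= 2 / (1 - r).
Proof.
move=> r01; apply: le_trans (sum_expr_dist_le n 0 r01); case/andP: r01 => r0 r1.
apply: ler_sum => j _; rewrite subn0 sub0n addn0 exprS ler_piMl ?exprn_ge0//.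
exact: ltW.
Qed.

(** Step [j] involves one interval on each side of [theta], each contributing at most [rho ^+ j.+1].
    The geometric series is at most [2 / (1 - rho)], which with the two sides gives the 4. *)
Lemma integral_sum_node_dist_le {d} {T : measurableType d} {R : realType}
    (P : probability T R) {n : nat} (X : {RV P >-> n.-tuple R}) (r theta : R) :
  (0 < n)%N -> deterministic_design X \/ random_design X ->
  0 <= r < 1 -> 0 <= theta <= 1 ->
  (\int[P]_w (\sum_(k < n.+1) `|node (X w) k - theta| * r ^+
        ((k - ncount (X w) theta) + (ncount (X w) theta - k)))%:E <=
   (2 / (1 - r) * (1 + 4 / (1 - expR (- (1 - r)))) / n%:R)%:E)%E.
Proof.
move=> n0 design r01 t01; have /andP[r0 r1] := r01; have /andP[t0 t1] := t01.
have nR0 : 0 < n%:R :> R by rewrite ltr0n.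
set rho := expR _.
have rho01 : 0 <= rho < 1 by rewrite expR_ge0 expR_lt1 oppr_lt0 subr_gt0.
have mX : measurable_fun setT X by exact: measurable_funP.
pose w_ (j : nat) : R := j.+1%:R / n%:R.
have w0 j : 0 <= w_ j by rewrite divr_ge0.
pose c1 (j : nat) : R := (theta + w_ j < 1)%R%:R.
pose c2 (j : nat) : R := (0 < theta - w_ j)%R%:R.
pose g (s t : R) w : R := r ^+ (ncount (X w) t - ncount (X w) s).
have g0 s t w : 0 <= g s t w by rewrite exprn_ge0.
have mg s t : measurable_fun setT (g s t).
  exact: (measurableT_comp (measurable_ncount2 s t (fun l m => r ^+ (m - l))) mX).
have bg j s : 0 <= s -> s + w_ j <= 1 ->
    (\int[P]_w (g s (s + w_ j)%R w)%:E <= (rho ^+ j.+1)%:E)%E.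
  by move=> s0 sj; apply: integral_expr_ncount_le; rewrite ?r0 ?(ltW r1).
pose h j w := c1 j * g theta (theta + w_ j) w + c2 j * g (theta - w_ j) theta w.
have h0 j w : 0 <= h j w by rewrite addr_ge0// mulr_ge0.
have mh j : measurable_fun setT (h j).
  by apply: measurable_funD; apply: measurable_funM.
have bh j : (\int[P]_w (h j w)%:E <= (2 * rho ^+ j.+1)%:E)%E.
  (* The boolean factor is the condition that the interval stays inside [[0, 1]], as [bg] requires;
     when it fails the term is 0. *)
  have cg (b : bool) s t : (b -> (\int[P]_w (g s t w)%:E <= (rho ^+ j.+1)%:E)%E) ->
      (\int[P]_w (b%:R * g s t w)%:E <= (rho ^+ j.+1)%:E)%E.
    case: b => [/(_ erefl) H|_].
      by under eq_integral do rewrite mul1r.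
    under eq_integral do rewrite mul0r.
    by rewrite integral0 lee_fin exprn_ge0// expR_ge0.
  rewrite mulr_natl mulr2n EFinD.
  under eq_integral do rewrite /h EFinD.
  have mc (c s t : R) : measurable_fun setT (fun w => (c * g s t w)%:E).
    by apply/measurable_EFinP; exact: measurable_funM.
  have pc (b : bool) s t w : (0 <= (b%:R * g s t w)%:E)%E by rewrite lee_fin mulr_ge0.
  rewrite (ge0_integralD _ _ (fun w _ => pc _ _ _ w) (mc _ _ _)
    (fun w _ => pc _ _ _ w) (mc _ _ _))//.
  apply: leeD; apply: cg => hj; first by apply: bg => //; exact: ltW.
  have := bg j (theta - w_ j); rewrite subrK; apply => //; exact: ltW.
set K := 2 / (1 - r).
have K0 : 0 <= K by rewrite divr_ge0// subr_ge0 ltW.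
have Kn0 : 0 <= K / n%:R by rewrite divr_ge0.
apply: (@le_trans _ _ (\int[P]_w ((K / n%:R)%:E * (1 + \sum_(j < n) h j w)%:E))%E).
  apply: ge0_le_integral => //.
  - move=> w _; rewrite lee_fin; apply: sumr_ge0 => k _.
    by rewrite mulr_ge0// exprn_ge0.
  - apply/measurable_EFinP; apply: measurable_sum => k; apply: measurable_funM.
      apply: measurableT_comp; first exact: normr_measurable.
      apply: measurable_funB => //.
      have kn : (k <= n)%N by rewrite -ltnS.
      exact: (measurableT_comp (measurable_node kn) mX).
    exact: (measurableT_comp (measurable_ncount2 theta theta
      (fun l _ => r ^+ ((k - l) + (l - k)))) mX).
  - apply: measurable_funeM; apply/measurable_EFinP; apply: measurable_funD => //.
    exact: measurable_sum.
  - move=> w _; rewrite -EFinM lee_fin.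
    by apply: sum_node_dist_le => //; [rewrite size_tuple|exact: sorted_design].
have ms : measurable_fun setT (fun w => (\sum_(j < n) h j w)%:E).
  by apply/measurable_EFinP; exact: measurable_sum.
have ps w : (0 <= (\sum_(j < n) h j w)%:E)%E by rewrite lee_fin sumr_ge0.
rewrite ge0_integralZl_EFin//; first last.
- apply/measurable_EFinP; apply: measurable_funD => //; exact: measurable_sum.
- by move=> w _; rewrite lee_fin addr_ge0// sumr_ge0.
have -> : K * (1 + 4 / (1 - rho)) / n%:R = K / n%:R * (1 + 2 * (2 / (1 - rho))).
  rewrite mulrAC; congr (_ * (1 + _)); rewrite mulrA; congr (_ / _); by rewrite -natrM.
rewrite (EFinM (K / n%:R)); apply: lee_wpmul2l; first by rewrite lee_fin.
under eq_integral do rewrite EFinD.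
rewrite (ge0_integralD _ _ _ _ (fun w _ => ps w) ms)//.
rewrite EFinD; apply: leeD; first by rewrite integral_cst// mul1e probability_le1.
under eq_integral do rewrite -sumEFin.
rewrite ge0_integral_sum//; first last.
- by move=> j w _; rewrite lee_fin.
- by move=> j; apply/measurable_EFinP.
apply: (@le_trans _ _ (\sum_(j < n) (2 * rho ^+ j.+1)%:E)%E); first exact: lee_sum.
by rewrite sumEFin lee_fin -mulr_sumr ler_wpM2l// sum_exprS_le.
Qed.

Lemma minimax_risk_le {d} {T : measurableType d} {R : realType}
    (P : probability T R) (sigma : R) {n : nat} (X : {RV P >-> n.-tuple R})
    (xi : 'I_n -> {RV P >-> R}) (r := expR (- (8 * sigma ^+ 2)^-1)) :
  (0 < n)%N -> 0 < sigma -> noise_model sigma X xi ->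
  deterministic_design X \/ random_design X ->
  (minimax_risk X xi segments_from_0 <=
   (2 / (1 - r) * (1 + 4 / (1 - expR (- (1 - r)))) / n%:R)%:E)%E.
Proof.
move=> n0 s0 model design.
have r01 : 0 <= r < 1.
  by rewrite expR_ge0 expR_lt1 oppr_lt0 invr_gt0 mulr_gt0// exprn_gt0.
pose lam := (2 * sigma ^+ 2)^-1.
have est : estimator (fun z : n.-tuple (R * R) => `[0, theta_hat lam z]%classic).
  exists (cst 0), (theta_hat lam); split => //; first exact: measurable_theta_hat.
  by move=> z; rewrite /= lexx ler01 theta_hat_itv.
apply: ge_ereal_inf; exists (risk X xi (fun z => `[0, theta_hat lam z]%classic) segments_from_0).
  by exists (fun z => `[0, theta_hat lam z]%classic).
apply: ge_ereal_sup => _ [_ [theta /= t01 <-] <-].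
move: t01; rewrite in_itv/= => t01; have /andP[t0 t1] := t01.
have mth : measurable_fun setT
    (fun w => theta_hat lam (observations X xi `[0%R, theta] w)).
  apply: (measurableT_comp (measurable_theta_hat lam)).
  exact: measurable_observations.
(* Read from the bottom: the loss is at most the distance of the endpoints, then the noise is
   integrated out, then the design. *)
apply: le_trans (integral_sum_node_dist_le n0 design r01 t01).
apply: le_trans (integral_theta_hat_dist_le s0 model _ (design_ge0 design) t01).
  apply: ge0_le_integral => //.
  - by apply: measurable_symdiff_itv.
  - apply/measurable_EFinP; apply: measurableT_comp; first exact: normr_measurable.
    exact: measurable_funB.
  - move=> w _; apply: lebesgue_measure_symdiff_itv0_le => //.
    by case/andP: (theta_hat_itv lam (observations X xi `[0, theta] w)).
by move=> w; exact: sorted_design.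
Qed.

Theorem theorem5 (R : realType) (sigma : R) (sigma_gt0 : 0 < sigma) :
  exists c C : R, [/\ 0 < c, 0 < C &
    exists n0 : nat, forall n : nat, (n0 <= n)%N ->
      forall (d : measure_display) (T : measurableType d)
        (P : probability T R) (X : {RV P >-> n.-tuple R})
        (xi : 'I_n -> {RV P >-> R}),
        noise_model sigma X xi ->
        deterministic_design X \/ random_design X ->
        ((c / n%:R)%:E <= minimax_risk X xi segments_from_0)%E /\
        (minimax_risk X xi segments_from_0 <= (C / n%:R)%:E)%E].
Proof.
pose r := expR (- (8 * sigma ^+ 2)^-1).
have r1 : 0 < 1 - r.
  by rewrite subr_gt0 expR_lt1 oppr_lt0 invr_gt0 mulr_gt0// exprn_gt0.
(* The lower constant is absolute; the upper one depends on [sigma] through [r]. *)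
exists 8^-1, (2 / (1 - r) * (1 + 4 / (1 - expR (- (1 - r))))); split => //.
  rewrite mulr_gt0 ?divr_gt0// addr_gt0// divr_gt0//.
  by rewrite subr_gt0 expR_lt1 oppr_lt0.
exists 1%N => n n1 d T P X xi model design; split.
  exact: minimax_risk_ge.
exact: minimax_risk_le.
Qed.
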